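(* Let $n$ be a positive integer. The map $o$ defines an inclusion (an injective group homomorphism) of the classical $n$-strand pure braid group into the group $\widetilde{PB}_n$.
   Context: $PB_n$ (the pure virtual braid group on $n$ strands) is the group with generators $a_{i,j}=a_{ij}$, $1\le i\neq j\le n$, and relations $a_{i,j}a_{i,k}a_{j,k}=a_{j,k}a_{i,k}a_{i,j}$ for all distinct $i,j,k$, and $a_{i,j}a_{k,l}=a_{k,l}a_{i,j}$ for all distinct $i,j,k,l$. The group $\widetilde{PB}_n$ is the quotient of $PB_n$ by the relations $a_{ij}=a_{ji}$ for all $1\le i\neq j\le n$. The map $o$ is defined as follows. Let $b$ be a classical pure braid on $n$ strands, given by a planar braid diagram (strands going from top to bottom, crossings at distinct heights). Number the strands globally by $1,\dots,n$ according to their endpoints (from left to right; since $b$ is pure, each strand has the same number at its top and bottom ends). Read the crossings of the diagram from top to bottom. At each crossing let $i$ be the number of the overcrossing strand and $j$ the number of the undercrossing strand. If the undercrossing strand approaches the crossing from the top-right, write $a_{ij}$; if the undercrossing strand approaches the crossing from the top-left, write $a_{ij}^{-1}$. The resulting word in the letters $a_{ij}^{\pm1}$ is $o(b)$, regarded here as an element of $\widetilde{PB}_n$. *)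

(* Defs.v *)
From HB Require Import structures.
From mathcomp Require Import all_boot all_fingroup.
From mathcomp Require Import boolp.

Set Implicit Arguments.
Unset Strict Implicit.
Unset Printing Implicit Defensive.

Import GroupScope.
Local Open Scope quotient_scope.

(* A letter (x, true) stands for x and (x, false) for its inverse. *)
Definition word (X : Type) := seq (X * bool).

Inductive word_congr (X : Type) (R : word X -> word X -> Prop) :
    word X -> word X -> Prop :=
| wc_refl u : word_congr R u u
| wc_sym u v : word_congr R u v -> word_congr R v u
| wc_trans v u w : word_congr R u v -> word_congr R v w -> word_congr R u w
| wc_cat u u' v v' :
    word_congr R u u' -> word_congr R v v' -> word_congr R (u ++ v) (u' ++ v')
| wc_cancel x b : word_congr R [:: (x, b); (x, ~~ b)] [::]
| wc_rel u v : R u v -> word_congr R u v.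

Definition word_eqv (X : choiceType) (R : word X -> word X -> Prop)
  (u v : word X) : bool := `[< word_congr R u v >].

Lemma word_eqv_equiv (X : choiceType) (R : word X -> word X -> Prop) :
  equiv_class_of (word_eqv R).
Proof.
split=> [u|u v|v u w].
- by apply/asboolP; apply: wc_refl.
- by apply/asboolP/asboolP; apply: wc_sym.
- by move=> /asboolP uv /asboolP vw; apply/asboolP; apply: wc_trans uv vw.
Qed.

Canonical word_equiv (X : choiceType) (R : word X -> word X -> Prop) :=
  EquivRelPack (word_eqv_equiv R).

(* The group with generators in X and a relation u = v whenever R u v. *)
Definition presented (X : choiceType) (R : word X -> word X -> Prop) :=
  {eq_quot (word_equiv R)}.

HB.instance Definition _ (X : choiceType) (R : word X -> word X -> Prop) :=
  Choice.on (presented R).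

Definition pres (X : choiceType) (R : word X -> word X -> Prop)
  (u : word X) : presented R := \pi_({eq_quot (word_equiv R)}) u.

Definition some_word (X : choiceType) (R : word X -> word X -> Prop)
  (g : presented R) : word X :=
  generic_quotient.repr (g : {eq_quot (word_equiv R)}).

Lemma presP (X : choiceType) (R : word X -> word X -> Prop) (u v : word X) :
  pres R u = pres R v <-> word_congr R u v.
Proof.
split=> [/eqquotP/asboolP //|uv].
by apply/eqquotP/asboolP.
Qed.

Lemma some_wordK (X : choiceType) (R : word X -> word X -> Prop)
  (g : presented R) : pres R (some_word g) = g.
Proof. exact: reprK. Qed.

Definition word_inv (X : Type) (u : word X) : word X :=
  rev [seq (c.1, ~~ c.2) | c <- u].

Lemma word_inv_cat (X : Type) (u v : word X) :
  word_inv (u ++ v) = word_inv v ++ word_inv u.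
Proof. by rewrite /word_inv map_cat rev_cat. Qed.

Lemma word_invK (X : Type) : involutive (@word_inv X).
Proof.
move=> u; rewrite /word_inv map_rev revK -map_comp -[RHS]map_id.
by apply: eq_map => -[x b] /=; rewrite negbK.
Qed.

Lemma word_mulV (X : Type) (R : word X -> word X -> Prop) (u : word X) :
  word_congr R (u ++ word_inv u) [::].
Proof.
elim: u => [|[x b] u IHu]; first exact: wc_refl.
rewrite -cat1s word_inv_cat catA -(catA [:: _]).
apply: wc_trans (wc_cancel R x b).
rewrite -[[:: _; _]]/([:: (x, b)] ++ ([::] ++ word_inv [:: (x, b)])) -catA.
exact/wc_cat/wc_cat/wc_refl/IHu/wc_refl.
Qed.

Lemma word_Vmul (X : Type) (R : word X -> word X -> Prop) (u : word X) :
  word_congr R (word_inv u ++ u) [::].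
Proof. by have := word_mulV R (word_inv u); rewrite word_invK. Qed.

Definition pres_one (X : choiceType) (R : word X -> word X -> Prop) :
  presented R := pres R [::].
Definition pres_mul (X : choiceType) (R : word X -> word X -> Prop)
  (g h : presented R) : presented R := pres R (some_word g ++ some_word h).
Definition pres_inv (X : choiceType) (R : word X -> word X -> Prop)
  (g : presented R) : presented R := pres R (word_inv (some_word g)).

Lemma congr_some_word (X : choiceType) (R : word X -> word X -> Prop) (u : word X) :
  word_congr R (some_word (pres R u)) u.
Proof. by apply/presP; rewrite some_wordK. Qed.

Lemma pres_mulE (X : choiceType) (R : word X -> word X -> Prop) (u v : word X) :
  pres_mul (pres R u) (pres R v) = pres R (u ++ v).
Proof. by apply/presP/wc_cat; apply: congr_some_word. Qed.

Lemma pres_mulA (X : choiceType) (R : word X -> word X -> Prop) :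
  associative (@pres_mul X R).
Proof.
move=> f g h; rewrite -(some_wordK f) -(some_wordK g) -(some_wordK h).
by rewrite !pres_mulE catA.
Qed.

Lemma pres_mul1g (X : choiceType) (R : word X -> word X -> Prop) :
  left_id (pres_one R) (@pres_mul X R).
Proof. by move=> g; rewrite -(some_wordK g) pres_mulE. Qed.

Lemma pres_mulg1 (X : choiceType) (R : word X -> word X -> Prop) :
  right_id (pres_one R) (@pres_mul X R).
Proof. by move=> g; rewrite -(some_wordK g) pres_mulE cats0. Qed.

Lemma pres_mulVg (X : choiceType) (R : word X -> word X -> Prop) :
  left_inverse (pres_one R) (@pres_inv X R) (@pres_mul X R).
Proof.
move=> g; rewrite -{2}(some_wordK g) pres_mulE.
by apply/presP/word_Vmul.
Qed.

Lemma pres_mulgV (X : choiceType) (R : word X -> word X -> Prop) :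
  right_inverse (pres_one R) (@pres_inv X R) (@pres_mul X R).
Proof.
move=> g; rewrite -{1}(some_wordK g) pres_mulE.
by apply/presP/word_mulV.
Qed.

HB.instance Definition _ (X : choiceType) (R : word X -> word X -> Prop) :=
  isGroup.Build (presented R) (@pres_mulA X R) (@pres_mul1g X R)
    (@pres_mulg1 X R) (@pres_mulVg X R) (@pres_mulgV X R).

Lemma presM (X : choiceType) (R : word X -> word X -> Prop) (u v : word X) :
  pres R (u ++ v) = pres R u * pres R v.
Proof. by rewrite -pres_mulE. Qed.

(* A braid diagram is read from top to bottom as a word in the crossings.  The
   crossing (i, b) involves the strands at positions i and i + 1, counted from
   the left and starting at 0; if b is true then the undercrossing strand
   approaches from the top-right, and if b is false from the top-left. *)
Definition braid_diagram (n : nat) := word 'I_n.-1.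

Lemma pos_left_subproof (n : nat) (i : 'I_n.-1) : i < n.
Proof. exact: leq_trans (ltn_ord i) (leq_pred n). Qed.

Lemma pos_right_subproof (n : nat) (i : 'I_n.-1) : i.+1 < n.
Proof. by rewrite -ltn_predRL. Qed.

Definition pos_left (n : nat) (i : 'I_n.-1) : 'I_n :=
  Ordinal (pos_left_subproof i).
Definition pos_right (n : nat) (i : 'I_n.-1) : 'I_n :=
  Ordinal (pos_right_subproof i).

Lemma pos_left_right (n : nat) (i : 'I_n.-1) : pos_left i != pos_right i.
Proof. by rewrite -val_eqE /= neq_ltn leqnn. Qed.

Inductive artin_rel (n : nat) : braid_diagram n -> braid_diagram n -> Prop :=
| artin_comm (i j : 'I_n.-1) : i.+1 < j ->
    artin_rel [:: (i, true); (j, true)] [:: (j, true); (i, true)]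
| artin_braid (i j : 'I_n.-1) : j = i.+1 :> nat ->
    artin_rel [:: (i, true); (j, true); (i, true)]
              [:: (j, true); (i, true); (j, true)].

(* Diagrams up to isotopy; the product b * b' has b on top of b'. *)
Definition braid (n : nat) := presented (@artin_rel n).
HB.instance Definition _ (n : nat) := Group.on (braid n).

Definition braid_of (n : nat) (D : braid_diagram n) : braid n :=
  pres (@artin_rel n) D.

Definition crossing_perm (n : nat) (i : 'I_n.-1) : 'S_n :=
  tperm (pos_left i) (pos_right i).

(* The strand with top endpoint p has bottom endpoint diagram_perm D p. *)
Definition diagram_perm (n : nat) (D : braid_diagram n) : 'S_n :=
  \prod_(c <- D) crossing_perm c.1.

Lemma diagram_perm_congr (n : nat) (D D' : braid_diagram n) :
  word_congr (@artin_rel n) D D' -> diagram_perm D = diagram_perm D'.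
Proof.
rewrite /diagram_perm; elim=> {D D'} //.
- by move=> D D' D'' _ -> _ ->.
- by move=> D1 D1' D2 D2' _ eq1 _ eq2; rewrite !big_cat /= eq1 eq2.
- by move=> i b; rewrite !big_cons big_nil /= mulg1 tperm2.
move=> _ _ [i j lt_ij|i j eq_ij]; rewrite !big_cons big_nil /= !mulg1.
  have lt_ij' : i < j := ltnW lt_ij.
  apply/commgP/conjg_fixP; rewrite tpermJ !tpermD // -val_eqE /=;
    by rewrite ?eqSS ?(gtn_eqF lt_ij) ?(gtn_eqF lt_ij') //
      ?(gtn_eqF (leqW lt_ij)) ?(gtn_eqF (leqW lt_ij')).
have lr_j : pos_left j = pos_right i by apply: val_inj.
have ri_j : pos_right i != pos_right j by rewrite -lr_j pos_left_right.
have li_rj : pos_left i != pos_right j by rewrite -val_eqE /= eq_ij ltn_eqF.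
rewrite /crossing_perm lr_j.
have conj (s t : 'S_n) : s * s = 1 -> s * (t * s) = t ^ s.
  by move=> ss; rewrite /conjg -[in RHS](mulg1 s^-1) -ss !mulgA mulVg mul1g.
rewrite !conj ?tperm2 // !tpermJ tpermR tpermL !tpermD // 1?eq_sym //.
by rewrite pos_left_right.
Qed.

Lemma diagram_perm_some_word (n : nat) (D : braid_diagram n) :
  diagram_perm (some_word (braid_of D)) = diagram_perm D.
Proof. exact/diagram_perm_congr/congr_some_word. Qed.

Definition is_pure (n : nat) : pred (braid n) :=
  [pred b | diagram_perm (some_word b) == 1].

Lemma is_pure_of (n : nat) (D : braid_diagram n) :
  is_pure (braid_of D) = (diagram_perm D == 1).
Proof. by rewrite -(diagram_perm_some_word D). Qed.

Lemma is_pure_group_closed (n : nat) : group_closed (@is_pure n).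
Proof.
have permM (b c : braid n) : diagram_perm (some_word (b * c)) =
    diagram_perm (some_word b) * diagram_perm (some_word c).
  have := diagram_perm_some_word (some_word b ++ some_word c).
  by rewrite /braid_of presM !some_wordK => ->; rewrite /diagram_perm big_cat.
have perm1 : diagram_perm (some_word (1 : braid n)) = 1.
  by rewrite (diagram_perm_some_word [::]) /diagram_perm big_nil.
split=> [|b c]; rewrite !inE ?perm1 // => /eqP b1 /eqP c1.
by rewrite permM b1 mul1g -perm1 -(mulgV c) permM c1 mul1g.
Qed.

(* The pure braid group, as the type of elements of a subgroup of braid n. *)
Record pure_braid (n : nat) := PureBraid {
  pure_val : braid n;
  _ : is_pure pure_val
}.

HB.instance Definition _ (n : nat) := [isSub for @pure_val n].
HB.instance Definition _ (n : nat) := [Choice of pure_braid n by <:].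
HB.instance Definition _ (n : nat) :=
  SubChoice_isSubGroup.Build (braid n) (@is_pure n) (pure_braid n)
    (@is_pure_group_closed n).

(* The pair (i, j) stands for the generator a_ij. *)
Definition arrow (n : nat) := {p : 'I_n * 'I_n | p.1 != p.2}.
HB.instance Definition _ (n : nat) := Choice.on (arrow n).

Definition arr (n : nat) (i j : 'I_n) (ij : i != j) : arrow n :=
  exist (fun p : 'I_n * 'I_n => p.1 != p.2) (i, j) ij.

(* The relations of the pure virtual braid group PB_n. *)
Inductive PB_rel (n : nat) : word (arrow n) -> word (arrow n) -> Prop :=
| PB_triple (i j k : 'I_n) (ij : i != j) (ik : i != k) (jk : j != k) :
    PB_rel [:: (arr ij, true); (arr ik, true); (arr jk, true)]
           [:: (arr jk, true); (arr ik, true); (arr ij, true)]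
| PB_comm (i j k l : 'I_n) (ij : i != j) (kl : k != l) :
    i != k -> i != l -> j != k -> j != l ->
    PB_rel [:: (arr ij, true); (arr kl, true)]
           [:: (arr kl, true); (arr ij, true)].

(* The quotient of PB_n by the additional relations a_ij = a_ji. *)
Inductive PBt_rel (n : nat) : word (arrow n) -> word (arrow n) -> Prop :=
| PBt_PB u v : PB_rel u v -> PBt_rel u v
| PBt_sym (i j : 'I_n) (ij : i != j) (ji : j != i) :
    PBt_rel [:: (arr ij, true)] [:: (arr ji, true)].

Definition PBt (n : nat) := presented (@PBt_rel n).
HB.instance Definition _ (n : nat) := Group.on (PBt n).

Definition PBt_of (n : nat) (u : word (arrow n)) : PBt n := pres (@PBt_rel n) u.

Lemma strands_neq (n : nat) (s : 'S_n) (p q : 'I_n) : p != q -> s p != s q.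
Proof. by rewrite (inj_eq perm_inj). Qed.

Lemma pos_right_left (n : nat) (i : 'I_n.-1) : pos_right i != pos_left i.
Proof. by rewrite eq_sym pos_left_right. Qed.

(* Here s p is the number of the strand at position p just above the first
   crossing.  Each letter records the overcrossing strand first: it is the one
   at the left position when the undercrossing strand comes from the top-right. *)
Fixpoint o_word_from (n : nat) (s : 'S_n) (D : braid_diagram n) :
    word (arrow n) :=
  match D with
  | [::] => [::]
  | (i, b) :: D' =>
      (if b then (arr (strands_neq s (pos_left_right i)), true)
       else (arr (strands_neq s (pos_right_left i)), false))
      :: o_word_from (crossing_perm i * s) D'
  end.

Definition o_word (n : nat) (D : braid_diagram n) : word (arrow n) :=
  o_word_from 1 D.

(* Main.v *)
Require Import Defs.
From HB Require Import structures.
From mathcomp Require Import all_boot all_order all_algebra all_fingroup.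
From mathcomp Require Import boolp zify.

(* Let A be the Artin group with one generator x_e for each pair e of strands,
   braid relations between pairs sharing a strand and commutation between
   disjoint pairs.  The symmetric group permutes the x_e, and a_ij = x_ij s_ij,
   with s_ij the transposition, identifies the group ~PB_n with a subgroup of the
   semidirect product of A by S_n; there o(b) becomes the word of b in the
   generators x_{i,i+1}.  So it suffices that the standard parabolic subgroup of
   A generated by the x_{i,i+1} is the braid group.  This follows from a set
   retraction of A onto it, after Charney-Paris and Blufstein-Paris: read a word
   while keeping track of the minimal representative v of the coset W_X w, where
   w is the image in the Coxeter group W of the letters read so far; a letter s
   is kept, as the letter v s v^-1 of X, if it fixes that coset, and is deleted
   otherwise. *)

Set Implicit Arguments.
Unset Strict Implicit.
Unset Printing Implicit Defensive.

(** * The canonical representation of a simply laced Coxeter group *)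

Section CoxeterGraph.

Import Order.TTheory GRing.Theory Num.Theory.
Local Open Scope ring_scope.

Variables (E : finType) (adj : rel E).
Hypotheses (adj_sym : symmetric adj) (adj_irr : irreflexive adj).

Implicit Types (s t e f : E) (u w : seq E) (v : {ffun E -> int}).

(* Twice the Gram matrix of the canonical form of the Coxeter group with
   m(e, f) = 3 if adj e f, and 2 otherwise. *)
Definition cartan e f : int := if e == f then 2 else if adj e f then -1 else 0.

Definition simple_root e : {ffun E -> int} := [ffun f => (f == e)%:R].

Definition coroot s v : int := \sum_f v f * cartan f s.

Definition reflect s v : {ffun E -> int} := v - simple_root s *~ coroot s v.

Definition act_word u v := foldr reflect v u.

Definition nonneg v := forall e, 0 <= v e.

Lemma cartan_sym e f : cartan e f = cartan f e.
Proof. by rewrite /cartan eq_sym adj_sym. Qed.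

Lemma cartan_diag e : cartan e e = 2.
Proof. by rewrite /cartan eqxx. Qed.

Lemma cartan_adj e f : adj e f -> cartan e f = -1.
Proof. by rewrite /cartan; case: eqVneq => [->|_ ->] //; rewrite adj_irr. Qed.

Lemma cartan_nadj e f : e != f -> ~~ adj e f -> cartan e f = 0.
Proof. by rewrite /cartan => /negPf-> /negPf->. Qed.

Lemma ffun_mulz v (m : int) e : (v *~ m) e = v e * m.
Proof.
case: m => m; first by rewrite -pmulrn ffunMnE -mulr_natr natz.
by rewrite NegzE mulrNz -pmulrn ffunE ffunMnE mulrN -mulr_natr natz.
Qed.

Lemma reflectE s v e : reflect s v e = v e - (e == s)%:R * coroot s v.
Proof. by rewrite !ffunE ffun_mulz ffunE. Qed.

Lemma coroot_is_additive s : zmod_morphism (coroot s).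
Proof.
move=> v v'; rewrite -sumrB; apply: eq_bigr => e _.
by rewrite !ffunE mulrBl.
Qed.
HB.instance Definition _ s :=
  GRing.isZmodMorphism.Build _ _ (coroot s) (coroot_is_additive s).

Lemma coroot_simple s e : coroot s (simple_root e) = cartan e s.
Proof.
rewrite /coroot (bigD1 e) //= big1 => [|f /negPf fe]; rewrite ffunE.
  by rewrite eqxx mul1r addr0.
by rewrite fe mul0r.
Qed.

Lemma reflect_is_additive s : zmod_morphism (reflect s).
Proof.
move=> v v'; by rewrite /reflect raddfB mulrzBr !opprD !opprK addrACA.
Qed.
HB.instance Definition _ s :=
  GRing.isZmodMorphism.Build _ _ (reflect s) (reflect_is_additive s).

Lemma act_cons s u v : act_word (s :: u) v = reflect s (act_word u v).
Proof. by []. Qed.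

Lemma act_word_is_additive u : zmod_morphism (act_word u).
Proof. by elim: u => [|s u IHu] v v' //; rewrite !act_cons IHu raddfB. Qed.
HB.instance Definition _ u :=
  GRing.isZmodMorphism.Build _ _ (act_word u) (act_word_is_additive u).

Lemma reflect_simple s e :
  reflect s (simple_root e) = simple_root e - simple_root s *~ cartan e s.
Proof. by rewrite /reflect coroot_simple. Qed.

Lemma reflect_self s : reflect s (simple_root s) = - simple_root s.
Proof. by rewrite reflect_simple cartan_diag mulrz_nat mulr2n opprD addrA subrr add0r. Qed.

Lemma reflect_adj s e :
  adj e s -> reflect s (simple_root e) = simple_root e + simple_root s.
Proof. by move=> es; rewrite reflect_simple cartan_adj // mulrN1z opprK. Qed.

Lemma reflect_nadj s e :
  e != s -> ~~ adj e s -> reflect s (simple_root e) = simple_root e.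
Proof. by move=> ne es; rewrite reflect_simple cartan_nadj // subr0. Qed.

Lemma reflectK s : involutive (reflect s).
Proof.
move=> v; rewrite {1}/reflect raddfB raddfMz /= coroot_simple cartan_diag.
rewrite /reflect -addrA -opprD -mulrzDr.
by rewrite (_ : coroot s v + _ = 0) ?subr0 // mulrzz; lia.
Qed.

Lemma sum_simple v : v = \sum_e simple_root e *~ v e.
Proof.
apply/ffunP=> f; rewrite sum_ffunE (bigD1 f) //= big1 => [|e fe].
  by rewrite ffun_mulz ffunE eqxx mul1r addr0.
by rewrite ffun_mulz ffunE eq_sym (negPf fe) mul0r.
Qed.

Lemma coroot_reflect s t v :
  coroot s (reflect t v) = coroot s v - cartan t s * coroot t v.
Proof. by rewrite /reflect raddfB raddfMz /= coroot_simple mulrzz. Qed.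

Lemma reflect_braid s t v : adj s t ->
  reflect s (reflect t (reflect s v)) = reflect t (reflect s (reflect t v)).
Proof.
move=> st; have ts : adj t s by rewrite adj_sym.
apply/ffunP=> e; rewrite !reflectE !coroot_reflect !cartan_diag.
rewrite (cartan_adj st) (cartan_adj ts).
move: (coroot s v) (coroot t v) (v e) => x y z.
by case: (e == s) (e == t) => -[] /=; lia.
Qed.

Lemma reflect_comm s t v : s != t -> ~~ adj s t ->
  reflect s (reflect t v) = reflect t (reflect s v).
Proof.
move=> ne st; have ts : ~~ adj t s by rewrite adj_sym.
have ne' : t != s by rewrite eq_sym.
apply/ffunP=> e; rewrite !reflectE !coroot_reflect.
by rewrite !cartan_nadj // !mul0r !subr0 addrAC.
Qed.

Lemma act_rcons u s v : act_word (rcons u s) v = act_word u (reflect s v).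
Proof. exact: foldr_rcons. Qed.

Lemma act_rev u : cancel (act_word u) (act_word (rev u)).
Proof.
elim: u => // s u IHu v.
by rewrite act_cons rev_cons act_rcons reflectK IHu.
Qed.

Lemma act_revK u : cancel (act_word (rev u)) (act_word u).
Proof. by rewrite -{2}(revK u); apply: act_rev. Qed.

(** * Lengths and signs of roots *)

(** No Coxeter group is built: words stand for the same element when they act alike on the root
    lattice. *)
Definition reduced u := forall u', act_word u' =1 act_word u -> (size u <= size u')%N.

(** For reduced [u] this weak bound on the length of [u s] amounts to the strict one, and it avoids
    a parity argument. *)
Definition no_descent u s :=
  forall u', act_word u' =1 act_word (rcons u s) -> (size u <= size u')%N.

(* If w s is not shorter than w then w maps the simple root of s to a positive
   root: induction on the length of w, splitting off a last letter t, and then,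
   if t is adjacent to s, possibly a last s before it. *)
Lemma no_descent_nonneg u s :
  reduced u -> no_descent u s -> nonneg (act_word u (simple_root s)).
Proof.
move: {2}(size u) (leqnn (size u)) s => k; elim: k u => [|k IHk] u le_u s.
  case: u le_u => // _ _ _ e; rewrite ffunE; exact: ler0n.
case/lastP: u le_u => [|w t]; first by move=> _ _ _ e; rewrite ffunE; exact: ler0n.
rewrite size_rcons ltnS => le_w red_u nd_u.
have size_u : size (rcons w t) = (size w).+1 by rewrite size_rcons.
have red_w : reduced w.
  move=> w' w'w; have := red_u (rcons w' t); rewrite !size_rcons ltnS.
  by apply=> v; rewrite !act_rcons w'w.
have ne_st : s != t.
  apply/eqP=> st; have: (size (rcons w t) <= size w)%N.
    by apply: nd_u => v; rewrite st !act_rcons reflectK.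
  by rewrite size_rcons ltnn.
rewrite act_rcons; case: (boolP (adj s t)) => adj_st; last first.
  rewrite reflect_nadj //; apply: IHk => // w' w'w.
  have := nd_u (rcons w' t); rewrite !size_rcons ltnS; apply=> v.
  by rewrite act_rcons w'w !act_rcons reflect_comm.
have adj_ts : adj t s by rewrite adj_sym.
have pos_t : nonneg (act_word w (simple_root t)).
  by apply: IHk => // u' /red_u; rewrite size_rcons => /ltnW.
rewrite reflect_adj //.
have [/(IHk _ le_w _ red_w) pos_s|] := pselect (no_descent w s).
  by rewrite raddfD => e; rewrite ffunE addr_ge0.
move/existsNP=> [w' /not_implyP[w'w /negP]]; rewrite -ltnNge => lt_w'.
have ww' : act_word w =1 act_word (rcons w' s).
  by move=> v; rewrite act_rcons w'w act_rcons reflectK.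
have size_w : size w = (size w').+1.
  apply/eqP; rewrite eqn_leq lt_w' andbT.
  by have := red_w (rcons w' s); rewrite size_rcons; apply=> v; rewrite ww'.
(* [s] sends the sum of the simple roots of [s] and [t] to that of [t], so [w'] and [t] form a
   shorter instance. *)
rewrite ww' act_rcons [reflect _ _]raddfD /= reflect_self reflect_adj // addrCA addNr addr0.
apply: IHk; first by rewrite ltnW // -size_w.
- move=> w'' w''w'; have := red_w (rcons w'' s); rewrite size_rcons size_w ltnS.
  by apply=> v; rewrite ww' !act_rcons w''w'.
- move=> w'' w''w'; have := nd_u (rcons (rcons w'' s) t).
  rewrite !size_rcons size_w !ltnS; apply=> v.
  by rewrite !act_rcons w''w' act_rcons ww' act_rcons reflect_braid.
Qed.

Lemma reduced_word u :
  exists2 u', act_word u' =1 act_word u & reduced u' /\ (size u' <= size u)%N.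
Proof.
pose P k := `[< exists2 u', size u' = k & act_word u' =1 act_word u >].
have exP : exists k, P k by exists (size u); apply/asboolP; exists u.
case: (ex_minnP exP) => k /asboolP[u' <- u'u] min; exists u' => //; split.
  by move=> w wu; apply: min; apply/asboolP; exists w => // v; rewrite wu.
by apply: min; apply/asboolP; exists u.
Qed.

(** If [s] is a descent of [u], it is not one of [u s], which sends the simple root of [s] to the
    opposite root. *)
Lemma root_sign u s :
  nonneg (act_word u (simple_root s)) \/ nonneg (- act_word u (simple_root s)).
Proof.
have [u0 u0u [red0 _]] := reduced_word u; rewrite -u0u.
have [/(no_descent_nonneg red0)|] := pselect (no_descent u0 s); first by left.
move/existsNP=> [w /not_implyP[ww /negP]]; rewrite -ltnNge => lt_w.
have [u1 u1w [red1 le1]] := reduced_word w; right.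
rewrite (_ : - _ = act_word u1 (simple_root s)).
  apply: no_descent_nonneg => // u' u'u1.
  apply: leq_trans (leq_trans le1 (ltnW lt_w)) (red0 _ _) => v.
  by rewrite u'u1 act_rcons u1w ww act_rcons reflectK.
by rewrite u1w ww act_rcons reflect_self raddfN.
Qed.

(** * The invariant bilinear form *)

Definition cartan_form v v' : int := \sum_e v' e * coroot e v.

Lemma coroot_self s v : coroot s (reflect s v) = - coroot s v.
Proof. rewrite coroot_reflect cartan_diag; lia. Qed.

Lemma cartan_form_reflectr s v v' :
  cartan_form v (reflect s v') = cartan_form v v' - coroot s v' * coroot s v.
Proof.
rewrite /cartan_form; under eq_bigr do rewrite reflectE mulrBl.
rewrite sumrB; congr (_ - _); rewrite (bigD1 s) //= eqxx mul1r.
by rewrite big1 ?addr0 // => e /negPf->; rewrite !mul0r.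
Qed.

Lemma cartan_form_reflectl s v v' :
  cartan_form (reflect s v) v' = cartan_form v v' - coroot s v' * coroot s v.
Proof.
rewrite /cartan_form; under eq_bigr do rewrite coroot_reflect mulrBr.
rewrite sumrB; congr (_ - _); rewrite [in RHS]/coroot mulr_suml.
by apply: eq_bigr => e _; rewrite mulrA cartan_sym.
Qed.

Lemma cartan_form_act u v v' :
  cartan_form (act_word u v) (act_word u v') = cartan_form v v'.
Proof.
elim: u => // s u IHu; rewrite !act_cons -IHu.
rewrite cartan_form_reflectl cartan_form_reflectr coroot_self; lia.
Qed.

Lemma cartan_form_simple e f :
  cartan_form (simple_root e) (simple_root f) = cartan e f.
Proof.
rewrite /cartan_form (bigD1 f) //= big1 => [|e' /negPf ne].
  by rewrite ffunE eqxx mul1r addr0 coroot_simple.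
by rewrite ffunE ne mul0r.
Qed.

(** By invariance of the form, an element carrying simple roots to simple roots preserves the type
    of relation between the generators. *)
Lemma act_simple_cartan u s s' t t' :
  act_word u (simple_root s) = simple_root t ->
  act_word u (simple_root s') = simple_root t' -> cartan t t' = cartan s s'.
Proof.
by move=> ust ust'; rewrite -!cartan_form_simple -ust -ust' cartan_form_act.
Qed.

(* An element w of the Coxeter group is encoded by the family of the images
   w(simple_root e). *)
Definition frame := {ffun E -> {ffun E -> int}}.

Definition frame_of u : frame := [ffun e => act_word u (simple_root e)].

(** Right multiplication by [s], computed from the images of the simple roots alone. *)
Definition move (r : frame) s : frame := [ffun e => r e - r s *~ cartan e s].

Lemma move_frame_of u s : move (frame_of u) s = frame_of (rcons u s).
Proof.
apply/ffunP=> e; rewrite !ffunE act_rcons reflect_simple.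
by rewrite raddfB raddfMz.
Qed.

Lemma moveE r s e : move r s e = r e - r s *~ cartan e s.
Proof. exact: ffunE. Qed.

Lemma frame_ofE u e : frame_of u e = act_word u (simple_root e).
Proof. exact: ffunE. Qed.

(** * The set retraction onto a standard parabolic subgroup *)

Section Retraction.

Variables (X : pred E) (B : groupType) (phi : E -> B).
Hypothesis phi_braid : forall s t, X s -> X t -> adj s t ->
  (phi s * phi t * phi s = phi t * phi s * phi t)%g.
Hypothesis phi_comm : forall s t, X s -> X t -> s != t -> ~~ adj s t ->
  (phi s * phi t = phi t * phi s)%g.

(** The coordinates of a root have one sign, so this sum vanishes on it exactly when the root lies
    in the span of [X]. *)
Definition height v : int := \sum_(e | ~~ X e) v e.

Lemma height_is_additive : zmod_morphism height.
Proof.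
by move=> v v'; rewrite -sumrB; apply: eq_bigr => e _; rewrite !ffunE.
Qed.
HB.instance Definition _ :=
  GRing.isZmodMorphism.Build _ _ height height_is_additive.

(* The frames of the minimal representatives of the cosets W_X w. *)
Definition minimal_frame (r : frame) := exists2 u, r = frame_of u &
  forall t, X t -> nonneg (act_word (rev u) (simple_root t)).

Lemma minimal_frame0 : minimal_frame (frame_of [::]).
Proof. by exists [::] => // t _ e; rewrite ffunE ler0n. Qed.

Lemma height_simple t : X t -> height (simple_root t) = 0.
Proof.
move=> Xt; rewrite /height big1 // => e; rewrite ffunE.
by case: eqVneq => // -> /negP.
Qed.

Lemma height0_parabolic u s : height (act_word u (simple_root s)) = 0 ->
  forall e, ~~ X e -> act_word u (simple_root s) e = 0.
Proof.
move=> h0; have h0' : height (- act_word u (simple_root s)) = 0.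
  by rewrite raddfN /= h0 oppr0.
case: (root_sign u s) => pos e Xe.
  by have /psumr_eq0P := h0; apply=> // f _; apply: pos.
have /psumr_eq0P := h0' => /(_ (fun f _ => pos f))/(_ e Xe)/eqP.
by rewrite ffunE oppr_eq0 => /eqP.
Qed.

(** This sum, rather than [height], is what is usually called the height of a root. *)
Definition total v : int := \sum_e v e.

Lemma total_is_additive : zmod_morphism total.
Proof.
by move=> v v'; rewrite -sumrB; apply: eq_bigr => e _; rewrite !ffunE.
Qed.
HB.instance Definition _ :=
  GRing.isZmodMorphism.Build _ _ total total_is_additive.

Lemma total_simple s : total (simple_root s) = 1.
Proof.
rewrite /total (bigD1 s) //= big1 => [|e /negPf ne]; rewrite ffunE ?ne //.
by rewrite eqxx addr0.
Qed.

Lemma simple_neq0 s : simple_root s != 0.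
Proof. by apply/eqP=> /(congr1 total)/eqP; rewrite total_simple raddf0. Qed.

Lemma act_eq0 u v : (act_word u v == 0) = (v == 0).
Proof.
by apply/eqP/eqP=> [/(congr1 (act_word (rev u)))|->]; rewrite ?act_rev raddf0.
Qed.

Lemma total_gt0 v : nonneg v -> v != 0 -> 1 <= total v.
Proof.
move=> pos; apply: contra_neqT; rewrite -ltNge => lt1.
have t0 : total v = 0.
  by apply/eqP; rewrite eq_le sumr_ge0 // andbT; move: lt1; lia.
by apply/ffunP=> e; rewrite ffunE; have /psumr_eq0P := t0; apply.
Qed.

(* If v is a minimal coset representative and the root v(s) lies in the span of X,
   then s = v^-1 v(s) is an integer combination of the positive roots v^-1(t),
   with t in X and coefficients of one sign, so only one t occurs. *)
Lemma minimal_height0 u s :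
  (forall t, X t -> nonneg (act_word (rev u) (simple_root t))) ->
  height (act_word u (simple_root s)) = 0 ->
  exists2 t, X t & act_word u (simple_root s) = simple_root t.
Proof.
move=> min_u /height0_parabolic; set c := act_word u _ => c0.
pose b t := act_word (rev u) (simple_root t).
have b_gt0 t : X t -> 1 <= total (b t).
  by move=> Xt; apply: total_gt0; [apply: min_u|rewrite act_eq0 simple_neq0].
have def_s : simple_root s = \sum_t b t *~ c t.
  rewrite -(act_rev u (simple_root s)) -/c {1}(sum_simple c) raddf_sum.
  by apply: eq_bigr => t _; rewrite raddfMz.
(* The weights [total (b t)] are at least 1 on [X], so this equation excludes coefficients of
   negative sign and then leaves a single one, equal to 1. *)
have cb_t : 1 = \sum_t total (b t) * c t.
  rewrite -(total_simple s) def_s raddf_sum; apply: eq_bigr => t _.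
  by rewrite raddfMz mulrzz.
have pos_c : nonneg c.
  case: (root_sign u s) => // neg t.
  have: 1 <= 0 :> int; last by [].
  rewrite {1}cb_t sumr_le0 // => t' _.
  have [Xt'|/c0->] := boolP (X t'); last by rewrite mulr0.
  apply: mulr_ge0_le0; first exact: le_trans (b_gt0 _ Xt').
  by have := neg t'; rewrite ffunE oppr_ge0.
have le_cb t : c t <= total (b t) * c t.
  have [/b_gt0 b1|/c0->] := boolP (X t); last by rewrite mulr0.
  by rewrite ler_peMl.
have: c != 0 by rewrite act_eq0 simple_neq0.
have [/existsP[t c_t] _|/existsPn c0' /eqP[]] := boolP [exists t, c t != 0]; last first.
  by apply/ffunP=> t; rewrite ffunE; apply/eqP; have := c0' t; rewrite negbK.
have Xt : X t by apply: contraNT c_t => /c0->.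
have c1 : c t + \sum_(t' | t' != t) c t' <= 1.
  have <- : \sum_t' c t' = c t + \sum_(t' | t' != t) c t' by rewrite (bigD1 t).
  by rewrite cb_t ler_sum.
have s0 : 0 <= \sum_(t' | t' != t) c t' by apply: sumr_ge0.
have ct1 : 1 <= c t by have := pos_c t; lia.
exists t => //; apply/ffunP=> e; rewrite ffunE; case: eqVneq => [->|ne]; first lia.
have /psumr_eq0P : \sum_(t' | t' != t) c t' = 0 by lia.
by apply.
Qed.

(** Otherwise [s] makes negative a positive root [b], the preimage of a simple root in [X]. As [s]
    changes only the coordinate at [s], [b] is a multiple of the simple root of [s], whose image
    [r s] then has height 0. *)
Lemma minimal_move r s :
  minimal_frame r -> height (r s) != 0 -> minimal_frame (move r s).
Proof.
case=> u -> min_u; rewrite frame_ofE => h_s; exists (rcons u s) => [|t Xt].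
  exact: move_frame_of.
rewrite rev_rcons; case: (root_sign (s :: rev u) t) => // neg.
case/eqP: h_s; set b := act_word (rev u) (simple_root t).
have b0 e : e != s -> b e = 0.
  move=> /negPf ne; have := neg e; have := min_u t Xt e.
  rewrite ffunE act_cons reflectE ne mul0r subr0 -/b; lia.
have def_b : b = simple_root s *~ b s.
  by apply/ffunP=> e; rewrite ffun_mulz ffunE; case: eqVneq => [->|/b0->];
    rewrite ?mul1r ?mul0r.
have def_t : simple_root t = act_word u (simple_root s) *~ b s.
  by rewrite -raddfMz -def_b /= act_revK.
(* The coordinate at [t] writes 1 as a product of two integers, and [b s] is nonnegative. *)
have /ffunP/(_ t) := def_t; rewrite ffun_mulz ffunE eqxx => bs1.
have bs : b s = 1.
  have := min_u t Xt s; rewrite -/b; move: bs1 => /=.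
  by move: (act_word _ _ _) (b s) => x y; have [] := lerP x 0; nia.
by rewrite -(height_simple Xt) def_t bs mulr1z.
Qed.

(* The value 1 for a root that is not simple in X is never used: by
   minimal_height0 a letter is kept only if its root is simple in X. *)
Definition emit v : B :=
  if [pick t | X t && (v == simple_root t)] is Some t then phi t else 1%g.

(** The sign of the letter is ignored, since generators are involutions in the Coxeter group. *)
Definition next (r : frame) (c : E * bool) :=
  if height (r c.1) == 0 then r else move r c.1.

Definition out (r : frame) (c : E * bool) : B :=
  if height (r c.1) == 0 then if c.2 then emit (r c.1) else (emit (r c.1))^-1%g
  else 1%g.

Fixpoint retract r (w : word E) : B :=
  if w is c :: w' then (out r c * retract (next r c) w')%g else 1%g.

Lemma retract_cat r (w w' : word E) :
  retract r (w ++ w') = (retract r w * retract (foldl next r w) w')%g.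
Proof. by elim: w r => [|c w IHw] r /=; rewrite ?mul1g // IHw mulgA. Qed.

Lemma minimal_next r c : minimal_frame r -> minimal_frame (next r c).
Proof. by rewrite /next; case: eqVneq => // h_c min_r; apply: minimal_move. Qed.

Lemma minimal_foldl r (w : word E) : minimal_frame r -> minimal_frame (foldl next r w).
Proof. by elim: w r => //= c w IHw r /(minimal_next c)/IHw. Qed.

Lemma simple_root_inj : injective simple_root.
Proof.
move=> s t /ffunP/(_ s)/eqP; rewrite !ffunE eqxx.
by case: (eqVneq s t).
Qed.

Lemma emit_simple t : X t -> emit (simple_root t) = phi t.
Proof.
rewrite /emit => Xt; case: pickP => [t' /andP[_ /eqP/simple_root_inj->] //|].
by move/(_ t); rewrite Xt eqxx.
Qed.

(** When both letters of a relation are kept, the letters written out satisfy a relation of the same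
    type. *)
Lemma emit_pair r s t : minimal_frame r ->
  height (r s) = 0 -> height (r t) = 0 -> exists s' t',
  [/\ X s', X t', emit (r s) = phi s', emit (r t) = phi t' &
      cartan s' t' = cartan s t].
Proof.
case=> u -> min_u; rewrite !frame_ofE.
move=> /(minimal_height0 min_u)[s' Xs' us] /(minimal_height0 min_u)[t' Xt' ut].
exists s', t'; rewrite us ut !emit_simple //; split=> //.
exact: act_simple_cartan us ut.
Qed.

Inductive graph_artin_rel : word E -> word E -> Prop :=
| graph_artin_comm s t : s != t -> ~~ adj s t ->
    graph_artin_rel [:: (s, true); (t, true)] [:: (t, true); (s, true)]
| graph_artin_braid s t : adj s t ->
    graph_artin_rel [:: (s, true); (t, true); (s, true)]
                    [:: (t, true); (s, true); (t, true)].

Lemma move_self r s : move r s s = - r s.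
Proof. by rewrite moveE cartan_diag mulrz_nat mulr2n opprD addrA subrr add0r. Qed.

Lemma move_adj r s e : adj e s -> move r s e = r e + r s.
Proof. by move=> es; rewrite moveE cartan_adj // mulrN1z opprK. Qed.

(** For adjacent letters, [s t] sends the simple root of [s] to that of [t]. *)
Lemma move_move r s t : adj s t -> move (move r s) t s = r t.
Proof.
move=> st; have ts : adj t s by rewrite adj_sym.
by rewrite move_adj // move_self move_adj // addrCA addNr addr0.
Qed.

Lemma move_nadj r s e : e != s -> ~~ adj e s -> move r s e = r e.
Proof. by move=> ne es; rewrite moveE cartan_nadj // subr0. Qed.

Lemma moveK r s : minimal_frame r -> move (move r s) s = r.
Proof.
case=> u -> _; rewrite !move_frame_of; apply/ffunP=> e.
by rewrite !frame_ofE !act_rcons reflectK.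
Qed.

Lemma move_braid r s t : minimal_frame r -> adj s t ->
  move (move (move r s) t) s = move (move (move r t) s) t.
Proof.
case=> u -> _ st; rewrite !move_frame_of; apply/ffunP=> e.
by rewrite !frame_ofE !act_rcons reflect_braid.
Qed.

Lemma move_comm r s t : minimal_frame r -> s != t -> ~~ adj s t ->
  move (move r s) t = move (move r t) s.
Proof.
case=> u -> _ ne st; rewrite !move_frame_of; apply/ffunP=> e.
by rewrite !frame_ofE !act_rcons reflect_comm.
Qed.

Lemma adj_cartan s t : adj s t = (cartan s t == -1).
Proof.
rewrite /cartan; case: (eqVneq s t) => [->|_]; first by rewrite adj_irr.
by case: (adj s t).
Qed.

Lemma nadj_cartan s t : (s != t) && ~~ adj s t = (cartan s t == 0).
Proof. by rewrite /cartan; case: (eqVneq s t) => //= _; case: (adj s t). Qed.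

(** Equality of the final states is included so that the relation passes to concatenations. *)
Definition same_run r (w w' : word E) :=
  foldl next r w = foldl next r w' /\ retract r w = retract r w'.

Lemma run_cancel r s b :
  minimal_frame r -> same_run r [:: (s, b); (s, ~~ b)] [::].
Proof.
move=> min_r; rewrite /same_run /= /next /out /=.
have [h0|h0] := eqVneq (height (r s)) 0.
  by rewrite h0 eqxx mulg1; case: b => /=; rewrite ?mulgV ?mulVg.
by rewrite move_self raddfN oppr_eq0 (negPf h0) moveK // !mulg1.
Qed.

Lemma run_comm r s t : minimal_frame r -> s != t -> ~~ adj s t ->
  same_run r [:: (s, true); (t, true)] [:: (t, true); (s, true)].
Proof.
move=> min_r ne st; rewrite /same_run /= /next /out /=.
have ne' : t != s by rewrite eq_sym.
have ts : ~~ adj t s by rewrite adj_sym.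
have [hs|hs] := eqVneq (height (r s)) 0; have [ht|ht] := eqVneq (height (r t)) 0.
- rewrite hs eqxx !mulg1; split=> //.
  have [s' [t' [Xs' Xt' -> -> st']]] := emit_pair min_r hs ht.
  have /andP[] : (s' != t') && ~~ adj s' t' by rewrite nadj_cartan st' cartan_nadj.
  exact: phi_comm.
- by rewrite (move_nadj r ne st) hs eqxx !mulg1 !mul1g.
- by rewrite (negPf hs) (move_nadj r ne' ts) ht eqxx !mulg1 !mul1g.
- rewrite (move_nadj r ne st) (move_nadj r ne' ts) (negPf hs) (negPf ht).
  by rewrite (move_comm min_r ne st).
Qed.

(** The coset may be fixed by both letters, by one of them, only by the third reflection [s t s], or
    by none of the three. *)
Lemma run_braid r s t : minimal_frame r -> adj s t ->
  same_run r [:: (s, true); (t, true); (s, true)] [:: (t, true); (s, true); (t, true)].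
Proof.
move=> min_r; have mixed x y : adj x y -> height (r x) = 0 -> height (r y) != 0 ->
    same_run r [:: (x, true); (y, true); (x, true)] [:: (y, true); (x, true); (y, true)].
  (* Exactly one letter of each word is kept, with root [r x]: the first [x] on the left, the last
     [y] on the right. *)
  move=> xy hx hy; have yx : adj y x by rewrite adj_sym.
  rewrite /same_run /= /next /out /= hx eqxx (negPf hy) /=.
  have hyx : height (move r y x) != 0 by rewrite (move_adj r xy) raddfD /= hx add0r.
  rewrite (negPf hyx) /=.
  by rewrite (move_move r yx) hx eqxx !mulg1 !mul1g.
move=> st; have ts : adj t s by rewrite adj_sym.
have [hs|hs] := eqVneq (height (r s)) 0; have [ht|ht] := eqVneq (height (r t)) 0.
- rewrite /same_run /= /next /out /= !(hs, ht, eqxx) /=.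
  rewrite !mulg1; split=> //; rewrite !mulgA.
  have [s' [t' [Xs' Xt' -> -> st']]] := emit_pair min_r hs ht.
  by apply: phi_braid; rewrite // adj_cartan st' cartan_adj.
- exact: mixed.
- have [e1 e2] := mixed t s ts ht hs; exact: conj (esym e1) (esym e2).
rewrite /same_run /= /next /out /= (negPf hs) (negPf ht) /=.
rewrite (move_adj r ts) (move_adj r st) [r s + r t]addrC.
(* If this height is 0, both words keep only their middle letter, with the same root, and the outer
   letters lead away from [r] and back. *)
have [hst|hst] := eqVneq (height (r t + r s)) 0.
  rewrite !move_self !raddfN !oppr_eq0 (negPf hs) (negPf ht).
  by rewrite !(moveK _ min_r).
rewrite (move_move r st) (move_move r ts) (negPf hs) (negPf ht) /=.
by rewrite (move_braid min_r st).
Qed.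

Lemma run_congr (w w' : word E) : word_congr graph_artin_rel w w' ->
  forall r, minimal_frame r -> same_run r w w'.
Proof.
elim=> {w w'} [//|w w' _ IH|w w1 w' _ IH _ IH'|u u' w w' _ IHu _ IHw|s b|].
- by move=> r /IH[].
- move=> r min_r; rewrite /same_run; have [-> ->] := IH _ min_r.
  exact: IH'.
- move=> r min_r; rewrite /same_run !foldl_cat !retract_cat.
  have [<- <-] := IHu _ min_r.
  by have [-> ->] := IHw _ (minimal_foldl u min_r).
- by move=> r; apply: run_cancel.
move=> _ _ [s t|s t] *; [exact: run_comm|exact: run_braid].
Qed.

Theorem retract_congr (w w' : word E) : word_congr graph_artin_rel w w' ->
  retract (frame_of [::]) w = retract (frame_of [::]) w'.
Proof. by move/run_congr/(_ _ minimal_frame0) => []. Qed.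

(** Letters of [X] fix the trivial coset, so the state stays at the identity and each letter is kept
    as it is. *)
Lemma retract_parabolic (w : word E) : all (fun c => X c.1) w ->
  retract (frame_of [::]) w =
    (\prod_(c <- w) (if c.2 then phi c.1 else (phi c.1)^-1))%g.
Proof.
elim: w => [|c w IHw] /=; first by rewrite big_nil.
case/andP=> Xc /IHw; rewrite big_cons /out /next frame_ofE height_simple // eqxx => ->.
by rewrite emit_simple.
Qed.

End Retraction.

End CoxeterGraph.

(** * The braid group and the Artin group on pairs of strands *)

Section Strands.

Import GroupScope.

Variable n : nat.
Implicit Types (s p : 'S_n) (i j : 'I_n.-1) (D : braid_diagram n).

(* A generator x_e is indexed by the pair of strands e as a set; the subsets that
   are not pairs only add generators, which is harmless. *)
Definition share_strand (A B : {set 'I_n}) := (A != B) && (#|A :&: B| == 1%N).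

Lemma share_strand_sym : symmetric share_strand.
Proof. by move=> A B; rewrite /share_strand eq_sym setIC. Qed.

Lemma share_strand_irr : irreflexive share_strand.
Proof. by move=> A; rewrite /share_strand eqxx. Qed.

Definition pos_pair i : {set 'I_n} := [set pos_left i; pos_right i].

(** The pairs of neighbouring positions form a path, the Coxeter graph of the braid group. *)
Lemma share_strand_pos_lt i j :
  i < j -> share_strand (pos_pair i) (pos_pair j) = (i.+1 == j).
Proof.
move=> lt_ij; have ne : pos_pair i != pos_pair j.
  apply/eqP=> /setP/(_ (pos_left i)); rewrite !inE -!val_eqE /=; lia.
rewrite /share_strand ne /=; case: (eqVneq i.+1 (j : nat)) => [eq_j|ne_j].
  rewrite (_ : _ :&: _ = [set pos_right i]) ?cards1 //.
  by apply/setP=> x; rewrite !inE -!val_eqE /=; lia.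
rewrite (_ : _ :&: _ = set0) ?cards0 //.
by apply/setP=> x; rewrite !inE -!val_eqE /=; lia.
Qed.

Lemma pos_pair_inj : injective pos_pair.
Proof.
move=> i j /setP eq_ij; apply: ord_inj.
have := eq_ij (pos_left i); have := eq_ij (pos_right i).
have := eq_ij (pos_left j); rewrite !inE -!val_eqE /=; lia.
Qed.

Definition positional (A : {set 'I_n}) := [exists i, A == pos_pair i].

Definition pair_braid (A : {set 'I_n}) : braid n :=
  if [pick i | A == pos_pair i] is Some i then braid_of [:: (i, true)] else 1.

Lemma pair_braid_pos i : pair_braid (pos_pair i) = braid_of [:: (i, true)].
Proof.
rewrite /pair_braid; case: pickP => [j /eqP/pos_pair_inj-> //|/(_ i)].
by rewrite eqxx.
Qed.

Lemma braid_of_cons2 c d D :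
  braid_of (c :: d :: D) = braid_of [:: c] * braid_of (d :: D).
Proof. by rewrite /braid_of -presM. Qed.

Lemma pair_braid_rel i j : i.+1 = j :> nat ->
  pair_braid (pos_pair i) * pair_braid (pos_pair j) * pair_braid (pos_pair i) =
  pair_braid (pos_pair j) * pair_braid (pos_pair i) * pair_braid (pos_pair j).
Proof.
move=> ij; rewrite !pair_braid_pos -!mulgA -!braid_of_cons2.
by apply/presP/wc_rel; apply: artin_braid.
Qed.

Lemma pair_braid_far i j : i.+1 < j ->
  pair_braid (pos_pair i) * pair_braid (pos_pair j) =
  pair_braid (pos_pair j) * pair_braid (pos_pair i).
Proof.
move=> ij; rewrite !pair_braid_pos -!braid_of_cons2.
by apply/presP/wc_rel; apply: artin_comm.
Qed.

Lemma pair_braid_braid A B : positional A -> positional B -> share_strand A B ->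
  pair_braid A * pair_braid B * pair_braid A =
  pair_braid B * pair_braid A * pair_braid B.
Proof.
move=> /existsP[i /eqP->] /existsP[j /eqP->].
have [ij|ji|/ord_inj->] := ltngtP i j; last by rewrite share_strand_irr.
  by rewrite share_strand_pos_lt // => /eqP; apply: pair_braid_rel.
by rewrite share_strand_sym share_strand_pos_lt // => /eqP /pair_braid_rel.
Qed.

Lemma pair_braid_comm A B : positional A -> positional B ->
  A != B -> ~~ share_strand A B -> pair_braid A * pair_braid B = pair_braid B * pair_braid A.
Proof.
move=> /existsP[i /eqP->] /existsP[j /eqP->].
have [ij _|ji _|/ord_inj->] := ltngtP i j; last by rewrite eqxx.
  by rewrite share_strand_pos_lt // => ne; apply: pair_braid_far; lia.
by rewrite share_strand_sym share_strand_pos_lt // => ne;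
  apply/esym/pair_braid_far; lia.
Qed.

(** * From words in the a_ij to words in the x_e *)

Definition arrow_pair p (a : arrow n) : {set 'I_n} :=
  [set p (val a).1; p (val a).2].

Definition arrow_swap p (a : arrow n) : 'S_n := tperm (val a).1 (val a).2 * p.

(** The component in A of the image in the semidirect product: [p] collects the transpositions moved
    to the right. An inverse letter yields the same pair, since a transposition preserves its own
    pair as a set. *)
Fixpoint pair_word p (w : word (arrow n)) : word {set 'I_n} :=
  if w is c :: w' then
    (arrow_pair p c.1, c.2) :: pair_word (arrow_swap p c.1) w'
  else [::].

Definition end_perm p (w : word (arrow n)) : 'S_n :=
  foldl (fun p c => arrow_swap p c.1) p w.

Lemma pair_word_cat p (u v : word (arrow n)) :
  pair_word p (u ++ v) = pair_word p u ++ pair_word (end_perm p u) v.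
Proof. by elim: u p => //= c u IHu p; rewrite IHu. Qed.

Lemma end_perm_cat p (u v : word (arrow n)) :
  end_perm p (u ++ v) = end_perm (end_perm p u) v.
Proof. exact: foldl_cat. Qed.

Lemma arrow_pairE p (x y : 'I_n) (xy : x != y) : arrow_pair p (arr xy) = [set p x; p y].
Proof. by []. Qed.

Lemma arrow_swapE p (x y : 'I_n) (xy : x != y) : arrow_swap p (arr xy) = tperm x y * p.
Proof. by []. Qed.

Definition same_pairs p (u v : word (arrow n)) :=
  word_congr (graph_artin_rel share_strand) (pair_word p u) (pair_word p v) /\
  end_perm p u = end_perm p v.

Lemma share_strand_common (x y z : 'I_n) : x != y -> x != z -> y != z ->
  share_strand [set x; y] [set x; z].
Proof.
move=> xy xz yz; have ne : [set x; y] != [set x; z].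
  by apply/eqP=> /setP/(_ y); rewrite !inE eqxx orbT eq_sym (negPf xy) (negPf yz).
rewrite /share_strand ne (_ : _ :&: _ = [set x]) ?cards1 //.
apply/setP=> t; rewrite !inE; case: (t == x) => //=.
by apply/negP=> /andP[/eqP->]; rewrite (negPf yz).
Qed.

(* x_xy x_yz x_xy = x_yz x_xy x_yz, after moving the transpositions to the right. *)
Lemma same_pairs_triple p (x y z : 'I_n) (xy : x != y) (xz : x != z) (yz : y != z) :
  same_pairs p [:: (arr xy, true); (arr xz, true); (arr yz, true)]
               [:: (arr yz, true); (arr xz, true); (arr xy, true)].
Proof.
have yx : y != x by rewrite eq_sym.
have zx : z != x by rewrite eq_sym.
have zy : z != y by rewrite eq_sym.
have exy : tperm x y z = z by rewrite tpermD.
have exz : tperm x z y = y by rewrite tpermD.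
have eyz : tperm y z x = x by rewrite tpermD.
rewrite /same_pairs /= !arrow_pairE !arrow_swapE.
rewrite !(permM, tpermL, tpermR, exy, exz, eyz); split.
  rewrite [[set p x; p y]]setUC.
  by apply/wc_rel/graph_artin_braid/share_strand_common; rewrite (inj_eq perm_inj).
apply/permP=> t; rewrite !permM; congr (p _).
have [->|tx] := eqVneq t x; first by rewrite !(tpermL, tpermR, exy, exz, eyz).
have [->|ty] := eqVneq t y; first by rewrite !(tpermL, tpermR, exy, exz, eyz).
have [->|tz] := eqVneq t z; first by rewrite !(tpermL, tpermR, exy, exz, eyz).
by rewrite !(@tpermD _ _ _ t) // eq_sym.
Qed.

Lemma same_pairs_comm p (x y z t : 'I_n) (xy : x != y) (zt : z != t) :
  x != z -> x != t -> y != z -> y != t ->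
  same_pairs p [:: (arr xy, true); (arr zt, true)] [:: (arr zt, true); (arr xy, true)].
Proof.
move=> xz xt yz yt.
rewrite /same_pairs /= !arrow_pairE !arrow_swapE !permM.
rewrite !(tpermD xz yz) !(tpermD xt yt) ![tperm z t _]tpermD 1?eq_sym //.
split; last first.
  rewrite !mulgA; congr (_ * _); apply/esym/commgP/conjg_fixP.
  by rewrite tpermJ !tpermD 1?eq_sym // 1?eq_sym.
have I0 : [set p x; p y] :&: [set p z; p t] = set0.
  apply/setP=> u; rewrite !inE; apply/negP=> /andP[/orP[]/eqP->];
  by rewrite !(inj_eq perm_inj) ?(negPf xz) ?(negPf xt) ?(negPf yz) ?(negPf yt).
apply/wc_rel/graph_artin_comm; last by rewrite /share_strand I0 cards0 andbF.
apply/eqP=> eq_xz; move: I0; rewrite -eq_xz setIid => /setP/(_ (p x)).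
by rewrite !inE eqxx.
Qed.

(** The map to the semidirect product respects the relations; a_ij = a_ji holds there because pairs
    and transpositions are unordered. *)
Lemma pair_word_congr (u v : word (arrow n)) :
  word_congr (@PBt_rel n) u v -> forall p, same_pairs p u v.
Proof.
elim=> {u v} [u|u v _ IH|u v w _ IHu _ IHv|u u' v v' _ IHu _ IHv|a b|u v rel_uv] p.
- by split; first exact: wc_refl.
- by have [uv euv] := IH p; split; [exact: wc_sym|].
- have [uv euv] := IHu p; have [vw evw] := IHv p.
  split; [exact: wc_trans uv vw|exact: etrans euv evw].
- have [uu' eu] := IHu p; have [vv' ev] := IHv (end_perm p u).
  split; last by rewrite !end_perm_cat ev eu.
  by rewrite !pair_word_cat -eu; apply: wc_cat.
- rewrite /same_pairs /= /arrow_pair /arrow_swap !permM tpermL tpermR mulgA tperm2 mul1g.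
  by split=> //; rewrite [X in (_, b) :: [:: (X, _)]]setUC; apply: wc_cancel.
case: rel_uv => [_ _ [x y z xy xz yz|x y z t xy zt]|x y xy yx].
- exact: same_pairs_triple.
- exact: same_pairs_comm.
- rewrite /same_pairs /= !arrow_pairE !arrow_swapE.
  by rewrite setUC tpermC; split=> //; apply: wc_refl.
Qed.

(** The collected permutation stays inverse to the current numbering, so it turns strand numbers
    back into positions. *)
Lemma pair_word_o s D :
  pair_word s^-1 (o_word_from s D) = [seq (pos_pair c.1, c.2) | c <- D].
Proof.
elim: D s => //= -[i b] D IHD s.
have inv_swap : tperm (s (pos_left i)) (s (pos_right i)) * s^-1 =
    (crossing_perm i * s)^-1.
  by rewrite -tpermJ conjgE mulgA invMg tpermV -!mulgA mulgV mulg1.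
case: b => /=; rewrite /arrow_pair /arrow_swap /= !permK; first by rewrite inv_swap IHD.
by rewrite tpermC inv_swap IHD setUC.
Qed.

Lemma braid_of_inv i : braid_of [:: (i, false)] = (braid_of [:: (i, true)])^-1.
Proof.
apply: (mulgI (braid_of [:: (i, true)])); rewrite mulgV /braid_of -presM.
by apply/presP/wc_cancel.
Qed.

Lemma braid_of_prod D :
  braid_of D = \prod_(c <- D) (if c.2 then pair_braid (pos_pair c.1)
                               else (pair_braid (pos_pair c.1))^-1).
Proof.
elim: D => [|[i b] D IHD]; first by rewrite big_nil.
rewrite big_cons -IHD pair_braid_pos -cat1s /braid_of presM; congr (_ * _).
by case: b; rewrite // -braid_of_inv.
Qed.

(** The retraction recovers the braid from the pair word of its [o_word]. *)
Lemma o_word_inj D D' :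
  word_congr (@PBt_rel n) (o_word D) (o_word D') -> braid_of D = braid_of D'.
Proof.
have retract_o D1 : retract share_strand positional pair_braid (frame_of share_strand [::])
    (pair_word 1 (o_word D1)) = braid_of D1.
  rewrite -[1]invg1 pair_word_o retract_parabolic.
    by rewrite big_map braid_of_prod.
  apply/allP=> _ /mapP[c _ ->] /=; apply/existsP; by exists c.1.
move/pair_word_congr/(_ 1)=> [eq_DD' _]; rewrite -(retract_o D) -(retract_o D').
apply: (retract_congr share_strand_sym share_strand_irr) eq_DD'.
- exact: pair_braid_braid.
- exact: pair_braid_comm.
Qed.

(** * Isotopy invariance of o *)

Lemma arr_eq (x y x' y' : 'I_n) (xy : x != y) (xy' : x' != y') :
  x = x' -> y = y' -> arr xy = arr xy'.
Proof. by move=> ex ey; apply: val_inj; rewrite /= ex ey. Qed.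

(** The strand at position q below [D] started at position [(diagram_perm D)^-1 q]. *)
Lemma o_word_from_cat s D D' :
  o_word_from s (D ++ D') =
    o_word_from s D ++ o_word_from ((diagram_perm D)^-1 * s) D'.
Proof.
rewrite /diagram_perm.
elim: D s => [|[i b] D IHD] s /=; first by rewrite big_nil invg1 mul1g.
by rewrite IHD big_cons invMg tpermV -mulgA.
Qed.

Lemma o_word_from_congr D D' : word_congr (@artin_rel n) D D' ->
  forall s, word_congr (@PBt_rel n) (o_word_from s D) (o_word_from s D').
Proof.
elim=> {D D'} [D|D D' _ IH|D D' D'' _ IH _ IH'|D1 D1' D2 D2' eq1 IH1 _ IH2|i b|D D' rel_DD'] s.
- exact: wc_refl.
- exact: wc_sym.
- exact: wc_trans (IH s) (IH' s).
- by rewrite !o_word_from_cat (diagram_perm_congr eq1); apply: wc_cat.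
(* Between the two crossings the strands exchange places, and the side of the overcrossing changes
   too, so both letters name the same arrow. *)
- rewrite /=; case: b => /=; set a := arr _; set a' := arr _;
    rewrite (_ : a' = a); try exact: wc_cancel;
    by apply: arr_eq; rewrite permM ?tpermL ?tpermR.
case: rel_DD' => i j ij.
- have ij' : i < j := ltnW ij.
  have [il ir] : crossing_perm j (pos_left i) = pos_left i /\
      crossing_perm j (pos_right i) = pos_right i.
    by split; apply: tpermD; rewrite -val_eqE /=; lia.
  have [jl jr] : crossing_perm i (pos_left j) = pos_left j /\
      crossing_perm i (pos_right j) = pos_right j.
    by split; apply: tpermD; rewrite -val_eqE /=; lia.
  apply/wc_rel/PBt_PB => /=.
  set a := arr _; set b := arr _; set c := arr _; set d := arr _.
  rewrite (_ : b = c); last by apply: arr_eq; rewrite permM ?jl ?jr.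
  rewrite (_ : d = a); last by apply: arr_eq; rewrite permM ?il ?ir.
  by apply: PB_comm; rewrite (inj_eq perm_inj) -val_eqE /=; lia.
- have lr : pos_left j = pos_right i by apply: val_inj.
  have ne : pos_left i != pos_right j by rewrite -val_eqE /=; lia.
  have ne' : pos_right i != pos_right j by rewrite -val_eqE /=; lia.
  have sw1 : crossing_perm i (pos_right j) = pos_right j by rewrite tpermD.
  have sw2 : crossing_perm j (pos_left i) = pos_left i.
    by rewrite tpermD // -val_eqE /=; lia.
  have sw3 : crossing_perm i (pos_right i) = pos_left i by rewrite tpermR.
  have sw4 : crossing_perm i (pos_left i) = pos_right i by rewrite tpermL.
  have sw5 : crossing_perm j (pos_right i) = pos_right j by rewrite -lr tpermL.
  have sw6 : crossing_perm j (pos_right j) = pos_right i by rewrite -lr tpermR.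
  (* With x, y, z the strands at the three positions from left to right, the two sides read a_xy
     a_xz a_yz and its reversal. *)
  have e1 : o_word_from s [:: (i, true); (j, true); (i, true)] =
      [:: (arr (strands_neq s (pos_left_right i)), true);
          (arr (strands_neq s ne), true); (arr (strands_neq s ne'), true)].
    by congr [:: (_, _); (_, _); (_, _)]; apply: arr_eq;
      rewrite !permM ?lr ?sw2 ?sw5 ?sw1 ?sw3 ?sw4.
  have e2 : o_word_from s [:: (j, true); (i, true); (j, true)] =
      [:: (arr (strands_neq s ne'), true); (arr (strands_neq s ne), true);
          (arr (strands_neq s (pos_left_right i)), true)].
    by congr [:: (_, _); (_, _); (_, _)]; apply: arr_eq;
      rewrite ?permM ?lr ?sw1 ?sw3 ?sw2 ?sw5 ?sw6.
  by rewrite e1 e2; apply/wc_rel/PBt_PB/PB_triple.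
Qed.

End Strands.

(** * The homomorphism on pure braids *)

Section PureBraids.

Import GroupScope.

Variable n : nat.

Definition o_map (b : pure_braid n) : PBt n := PBt_of (o_word (some_word (val b))).

Lemma o_mapE (D : braid_diagram n) (b : pure_braid n) :
  val b = braid_of D -> o_map b = PBt_of (o_word D).
Proof.
move=> bD; apply/presP/o_word_from_congr; rewrite bD.
exact: congr_some_word.
Qed.

(** Since the upper braid is pure, the numbering is again the identity where the lower one starts,
    so the words concatenate. *)
Lemma o_mapM : {morph o_map : b c / b * c}.
Proof.
move=> b c; pose Db := some_word (val b).
have pure_b : diagram_perm Db = 1 by apply/eqP; exact: (valP b).
have bcD : val (b * c) = braid_of (Db ++ some_word (val c)).
  by rewrite /braid_of presM !some_wordK.
rewrite (o_mapE bcD) /o_word o_word_from_cat pure_b invg1 mul1g.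
exact: presM.
Qed.

Lemma o_map_inj : injective o_map.
Proof.
move=> b c /presP/o_word_inj; rewrite /braid_of !some_wordK.
exact: val_inj.
Qed.

HB.instance Definition _ :=
  isMultiplicative.Build (pure_braid n) (PBt n) o_map o_mapM.

End PureBraids.

Theorem theorem1 (n : nat) (n_gt0 : 0 < n) :
  exists o : {multiplicative pure_braid n -> PBt n},
    (forall (D : braid_diagram n) (b : pure_braid n),
        val b = braid_of D -> o b = PBt_of (o_word D))
    /\ injective o.
Proof. by exists (@o_map n); split; [exact: o_mapE|exact: o_map_inj]. Qed.
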